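(* Fix $\alpha\in(0,2]$ and fix any sequence of measurable estimation functions $\{\hat A_n\}_{n=1}^\infty$, $\hat A_n:[0,1)\times\{0,1\}^n\to[0,1]$. Let $c=\sqrt{8/3}$ and define $\mathcal{Q}\subseteq[1/4,3/4]$ as the set of all $p\in[1/4,3/4]$ such that $$\limsup_{m\to\infty}\left[\frac{1}{V_m(\alpha)}\sum_{n=1}^m\mathbb{E}_p\left[|A_n^p-p|^\alpha\right]\right]\ \ge\ \frac{1}{c^\alpha 2^{3+2\alpha}},\qquad\text{where } V_m(\alpha)=\sum_{n=1}^m (1/n)^{\alpha/2}. \qquad ( * )$$ Then $\mathcal{Q}$ is Lebesgue measurable and its Lebesgue measure satisfies $\mu(\mathcal{Q})\ge 1/6$. Thus, a $p$ chosen uniformly at random in $[1/4,3/4]$ satisfies the inequality $( * )$ with probability at least $1/3$. In particular, the inequality $( * )$ for a given $p$ implies: - if $\alpha=2$, then $$\limsup_{m\to\infty}\left[\frac{1}{\log(m+1)}\sum_{n=1}^m\mathbb{E}_p\left[|A_n^p-p|^2\right]\right]\ge\frac{3}{2^{10}};$$ - if $\alpha=1$, then $$\limsup_{m\to\infty}\left[\frac{1}{(m+1)^{1/2}-1}\sum_{n=1}^m\mathbb{E}_p\left[|A_n^p-p|\right]\right]\ge\frac{1}{2^4\sqrt{8/3}}.$$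
   Context: $\log$ is the natural logarithm. For $p\in[0,1]$, let $\{W_n^p\}_{n=1}^\infty$ be an i.i.d. sequence of Bernoulli random variables with $P[W_n^p=1]=p$, $P[W_n^p=0]=1-p$. Let $U$ be a random variable uniformly distributed on $[0,1)$ and independent of $\{W_n^p\}_{n=1}^\infty$. An estimation function is a measurable function $\hat A_n:[0,1)\times\{0,1\}^n\to[0,1]$ (its first argument is a random seed); it does not depend on $p$. For each $n\in\{1,2,3,\dots\}$ the estimate of $p$ is $A_n^p=\hat A_n(U,W_1^p,\dots,W_n^p)$. $\mathbb{E}_p[\cdot]$ denotes expectation with respect to the joint law of $U$ and $\{W_n^p\}_{n=1}^\infty$. *)

(* Defs.v *)
(* MathComp-Analysis *)
From HB Require Import structures.
From mathcomp Require Import all_boot all_order all_algebra finmap.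
From mathcomp Require Import all_classical all_reals all_analysis.
From mathcomp Require Import lra.

Set Implicit Arguments.
Unset Strict Implicit.
Unset Printing Implicit Defensive.

Import Order.TTheory GRing.Theory Num.Theory.
Import numFieldNormedType.Exports.

Local Open Scope classical_set_scope.
Local Open Scope ring_scope.

(* Mutual independence of a sequence: product rule over every finite
   subfamily. *)
Definition mutually_independent (R : realType) (d d' : measure_display)
    (Omega : measurableType d) (T : measurableType d')
    (P : probability Omega R) (X : nat -> {RV P >-> T}) : Prop :=
  forall (J : {fset nat}) (B : nat -> set T),
    (forall i, measurable (B i)) ->
    P (\bigcap_(i in [set` J]) (X i @^-1` B i)) =
    (\prod_(i <- J) P (X i @^-1` B i))%E.

Definition sigma_seq (d d' : measure_display)
    (Omega : measurableType d) (T : measurableType d')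
    (X : nat -> Omega -> T) : set (set Omega) :=
  <<s \bigcup_i preimage_set_system setT (X i) measurable >>.

Definition independent_of_seq (R : realType) (d d' d'' : measure_display)
    (Omega : measurableType d) (S : measurableType d')
    (T : measurableType d'') (P : probability Omega R)
    (U : {RV P >-> S}) (X : nat -> {RV P >-> T}) : Prop :=
  forall (B : set S) (E : set Omega),
    measurable B -> sigma_seq (fun i => X i : Omega -> T) E ->
    P ((U @^-1` B) `&` E) = (P (U @^-1` B) * P E)%E.

(* The seed distribution: [uniform_prob] lives on the closed interval [0, 1],
   so the range condition is what restricts the seed to [0, 1). *)
Definition uniform_seed (R : realType) (d : measure_display)
    (Omega : measurableType d) (P : probability Omega R)
    (U : {RV P >-> R}) : Prop :=
  (forall omega, 0 <= U omega < 1) /\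
  (forall B : set R, measurable B ->
     distribution P U B = uniform_prob (@ltr01 R) B).

(* Indices are shifted: [W i] is the (i+1)-st variable of the sequence. *)
Definition iid_bernoulli (R : realType) (d : measure_display)
    (Omega : measurableType d) (P : probability Omega R)
    (p : R) (W : nat -> {RV P >-> bool}) : Prop :=
  mutually_independent W /\
  forall i, P (W i @^-1` [set true]) = p%:E /\
            P (W i @^-1` [set false]) = (1 - p)%:E.

(* The first argument is only constrained on [0, 1): the values of [A]
   elsewhere are never used. *)
Definition estimation_function (R : realType) (n : nat)
    (A : R * n.-tuple bool -> R) : Prop :=
  measurable_fun ([set u : R | 0 <= u < 1] `*` [set: n.-tuple bool]) A /\
  forall (u : R) (w : n.-tuple bool), 0 <= u < 1 -> 0 <= A (u, w) <= 1.

Definition estimate (R : realType) (Omega : Type)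
    (A : forall n : nat, R * n.-tuple bool -> R)
    (U : Omega -> R) (W : nat -> Omega -> bool) (n : nat) : Omega -> R :=
  fun omega => A n (U omega, [tuple W i omega | i < n]).

Definition V (R : realType) (alpha : R) (m : nat) : R :=
  \sum_(1 <= n < m.+1) (1 / n%:R) `^ (alpha / 2).

(* The inequality on the limit superior for the parameter [p], for a sequence
   [X] of estimates of [p]. The limit superior ignores [m = 0], where
   [V alpha m = 0]. *)
Definition error_bound (R : realType) (d : measure_display)
    (Omega : measurableType d) (P : probability Omega R)
    (alpha p : R) (X : nat -> Omega -> R) : Prop :=
  ((1 / (Num.sqrt (8 / 3) `^ alpha * 2 `^ (3 + 2 * alpha)))%:E <=
   limn_esup (fun m : nat =>
     (1 / V alpha m)%:E *
     \sum_(1 <= n < m.+1) 'E_P[fun omega => (`|X n omega - p| `^ alpha)%R]))%E.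

(* Lebesgue (not only Borel) measurability: this is the sigma-algebra on which
   [completed_lebesgue_measure] is a measure. *)
Definition lebesgue_measurable (R : realType) (A : set R) : Prop :=
  (((wlength (@idfun R))^*)%mu).-cara.-measurable A.

Lemma quarters_lt (R : realType) : 1 / 4 < 3 / 4 :> R.
Proof. lra. Qed.

(* Main.v *)
Require Import Defs.
From mathcomp Require Import all_boot all_order all_algebra finmap.
From mathcomp Require Import all_classical all_reals all_analysis.
From mathcomp Require Import measurable_realfun ring lra.
Import Order.TTheory GRing.Theory Num.Theory.
Import numFieldNormedType.Exports.
Local Open Scope classical_set_scope.
Local Open Scope ring_scope.

(** Write [f_n(p)] for the error of the [n]-th estimate at the parameter [p].
    If [p] and [q] lie in [1/4, 3/4] at distance of order [1/sqrt n], the laws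
    of [n] samples under [p] and under [q] overlap in mass at least [1/2]
    ([sum_min_word_prob]). On the overlap the same guess [a] is made for both
    parameters, and [|a - p|^alpha + |a - q|^alpha] is at least
    [(|p - q| / 2)^alpha]. Hence [f_n(p) + f_n(p + gap_n)] is at least
    [B * n^(-alpha/2)], where [B] is four times the constant of the theorem
    ([risk_pair_ge], [gap_powR]).

    The pair bound survives truncation: [g_n := min(f_n, B * n^(-alpha/2))]
    satisfies it too, and is bounded above. Integrating it over the interval
    [D] = [1/4, 3/4], with the translation invariance of Lebesgue measure,
    gives [\int_D g_n] at least [B/2 * n^(-alpha/2) * (|D| - gap_n)]. As [gap_n]
    tends to [0] and the weights [n^(-alpha/2)] have a divergent sum, the
    weighted means [G_m := (\sum_(n <= m) g_n) / V_m], which are bounded by [B],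
    have integrals with limit inferior at least [B/2 * |D|]. Where
    [limsup G_m < B/4], one has [liminf (B - G_m) > 3B/4]; Fatou's lemma for
    [B - G_m] thus shows that the set of these [p] has measure at most
    [2/3 * |D|], and the complementary third is the claim ([paired_limsup_bounded],
    [paired_limsup]).

    Measurability in [p] is obtained from an explicit formula: the error is a
    finite sum over the words [w] in [{0,1}^n] of the probability of [w], which
    is a polynomial in [p], times an integral over the seed, which is measurable
    in [p] by Tonelli's theorem ([estimate_risk], [measurable_risk]). The two
    special cases compare [V_m] with [log (m+1)] and [2 (sqrt (m+1) - 1)]. *)

Set Implicit Arguments.
Unset Strict Implicit.
Unset Printing Implicit Defensive.

Local Notation mu := lebesgue_measure.

(** * Overlap of the laws of [n] coin tosses *)

Definition word_prob (R : realType) (p : R) n (w : n.-tuple bool) : R :=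
  \prod_(i < n) (if tnth w i then p else 1 - p).

Lemma sum_tuple_prod (R : realType) n (F : bool -> R) :
  \sum_(w : n.-tuple bool) \prod_(i < n) F (tnth w i) =
  (F true + F false) ^+ n.
Proof.
pose tof (f : {ffun 'I_n -> bool}) := [tuple f i | i < n].
rewrite (reindex tof) /=; last first.
  exists (fun w : n.-tuple bool => [ffun i => tnth w i]) => w _.
  - by apply/ffunP => i; rewrite ffunE tnth_mktuple.
  - by apply: eq_from_tnth => i; rewrite tnth_mktuple ffunE.
transitivity (\prod_(i < n) \sum_(b : bool) F b).
  rewrite bigA_distr_bigA/=; apply: eq_bigr => f _.
  by apply: eq_bigr => i _; rewrite tnth_mktuple.
by rewrite prodr_const card_ord big_bool.
Qed.

Lemma word_prob_ge0 (R : realType) (p : R) n (w : n.-tuple bool) :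
  0 <= p <= 1 -> 0 <= word_prob p w.
Proof. by move=> p01; apply: prodr_ge0 => i _; case: ifP => _; lra. Qed.

Lemma word_prob_gt0 (R : realType) (p : R) n (w : n.-tuple bool) :
  0 < p < 1 -> 0 < word_prob p w.
Proof. by move=> p01; apply: prodr_gt0 => i _; case: ifP => _; lra. Qed.

Lemma sum_word_prob (R : realType) (p : R) n :
  \sum_(w : n.-tuple bool) word_prob p w = 1.
Proof.
rewrite (sum_tuple_prod n (fun b => if b then p else 1 - p)).
by rewrite addrC subrK expr1n.
Qed.

(** The second moment of the likelihood ratio; it is multiplicative over
    independent tosses, which makes it the convenient measure of overlap. *)
Lemma sum_word_prob_sqr_div (R : realType) (p q : R) n : 0 < q < 1 ->
  \sum_(w : n.-tuple bool) word_prob p w ^+ 2 / word_prob q w =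
  (1 + (p - q) ^+ 2 / (q * (1 - q))) ^+ n.
Proof.
move=> q01.
transitivity (\sum_(w : n.-tuple bool) \prod_(i < n)
    (if tnth w i then p ^+ 2 / q else (1 - p) ^+ 2 / (1 - q))).
  apply: eq_bigr => w _; rewrite /word_prob -prodrXl -prodfV -big_split/=.
  by apply: eq_bigr => i _; case: ifP.
rewrite (sum_tuple_prod n (fun b => if b then p ^+ 2 / q
  else (1 - p) ^+ 2 / (1 - q))); congr (_ ^+ _).
by field; apply/andP; split; lra.
Qed.

Lemma bernoulli_ineq (R : realType) (x : R) n :
  x <= 1 -> 1 - n%:R * x <= (1 - x) ^+ n.
Proof.
move=> x1; elim: n => [|n IH]; first by rewrite expr0; lra.
rewrite exprS; have : (1 - x) * (1 - n%:R * x) <= (1 - x) * (1 - x) ^+ n.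
  by apply: ler_wpM2l => //; lra.
apply: le_trans; rewrite -natr1; have : 0 <= n%:R * x ^+ 2.
  by rewrite mulr_ge0 ?sqr_ge0.
lra.
Qed.

(** With [x] and [y] the probabilities of a word under [p] and [q], the square
    [(y - x / 2) ^+ 2 / y >= 0] gives [min x y >= x - x ^+ 2 / (4 y)]. Summed
    over all words, the overlap is at least [1 - (1 + s) ^+ n / 4], where
    [s = (p - q) ^+ 2 / (q (1 - q))]. As [q (1 - q) >= 3 / 16], the last
    hypothesis gives [n s <= 1 / 2], and then [(1 + s) ^+ n <= (1 - s) ^- n <= 2]. *)
Lemma sum_min_word_prob (R : realType) (p q : R) n :
  1 / 4 <= p <= 3 / 4 -> 1 / 4 <= q <= 3 / 4 ->
  n%:R * (p - q) ^+ 2 <= 3 / 32 ->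
  1 / 2 <= \sum_(w : n.-tuple bool) Num.min (word_prob p w) (word_prob q w).
Proof.
move=> hp hq hn.
have q01 : 0 < q < 1 by lra.
have p01 : 0 < p < 1 by lra.
have key (w : n.-tuple bool) :
    word_prob p w - (word_prob p w ^+ 2 / word_prob q w) / 4 <=
    Num.min (word_prob p w) (word_prob q w).
  move: (word_prob_gt0 w p01) (word_prob_gt0 w q01).
  set x := word_prob p w; set y := word_prob q w => x0 y0.
  rewrite le_min; apply/andP; split.
    by rewrite lerBlDr lerDl divr_ge0// divr_ge0 ?sqr_ge0 ?ltW.
  rewrite -subr_ge0.
  have -> : y - (x - x ^+ 2 / y / 4) = (y - x / 2) ^+ 2 / y.
    by field; rewrite gt_eqF.
  by rewrite divr_ge0 ?sqr_ge0 ?ltW.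
apply: le_trans (ler_sum _ (fun w _ => key w)).
rewrite sumrB sum_word_prob -mulr_suml sum_word_prob_sqr_div//.
set s := (_ / (q * _)).
have s0 : 0 <= s by rewrite /s divr_ge0 ?sqr_ge0 ?mulr_ge0//; lra.
have qq : 3 / 16 <= q * (1 - q) by nra.
have ns : n%:R * s <= 1 / 2.
  by rewrite /s mulrA ler_pdivrMr; lra.
suff : (1 + s) ^+ n <= 2 by lra.
case: (posnP n) => [->|n0]; first by rewrite expr0; lra.
have n1 : 1 <= n%:R :> R by rewrite ler1n.
have s1 : s <= 1 / 2 by apply: le_trans ns; rewrite ler_peMl.
have b1 : 1 / 2 <= (1 - s) ^+ n.
  by apply: (@le_trans _ _ (1 - n%:R * s)); [lra|apply: bernoulli_ineq; lra].
have b2 : (1 + s) ^+ n * (1 - s) ^+ n <= 1.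
  rewrite -exprMn exprn_ile1//; first by nra.
  by nra.
have : 0 <= (1 + s) ^+ n by rewrite exprn_ge0//; lra.
nra.
Qed.

(** * Risk of a randomized estimator *)

(** The expected [alpha]-th power error of an estimator with seed law [nu],
    written as a mixture over words: the dependence on [p] is explicit, although
    the sample sequences for different [p] are unrelated. *)
Definition risk d (T : measurableType d) (R : realType) (nu : probability T R)
    (alpha : R) n (a : n.-tuple bool -> T -> R) (p : R) : \bar R :=
  (\sum_(w : n.-tuple bool)
     (word_prob p w)%:E * \int[nu]_u (`|a w u - p| `^ alpha)%:E)%E.

Lemma risk_ge0 d (T : measurableType d) (R : realType) (nu : probability T R)
    (alpha : R) n (a : n.-tuple bool -> T -> R) (p : R) :
  0 <= p <= 1 -> (0 <= risk nu alpha a p)%E.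
Proof.
move=> p01; apply: sume_ge0 => w _; apply: mule_ge0.
  by rewrite lee_fin word_prob_ge0.
by apply: integral_ge0 => u _; rewrite lee_fin powR_ge0.
Qed.

Lemma measurable_word_prob (R : realType) n (w : n.-tuple bool) :
  measurable_fun [set: R] (fun p => word_prob p w).
Proof.
apply: measurable_prod => i _; case: (tnth w i) => //.
exact: measurable_funB.
Qed.

Lemma measurable_abs_powR d (T : measurableType d) (R : realType) (alpha : R)
    (f : T -> R) : measurable_fun setT f ->
  measurable_fun setT (fun u => `|f u| `^ alpha).
Proof.
move=> mf; apply: (measurableT_comp (measurable_powR alpha)).
exact: measurableT_comp.
Qed.

Lemma measurable_risk d (T : measurableType d) (R : realType)
    (nu : probability T R) (alpha : R) n (a : n.-tuple bool -> T -> R) :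
  (forall w, measurable_fun setT (a w)) ->
  measurable_fun [set: R] (risk nu alpha a).
Proof.
move=> ma; apply: emeasurable_sum => w; apply: emeasurable_funM.
  by apply/measurable_EFinP; exact: measurable_word_prob.
have mf : measurable_fun setT
    (fun pu : measurableTypeR R * T => (`|a w pu.2 - pu.1| `^ alpha)%:E).
  apply/measurable_EFinP; apply: measurable_abs_powR.
  apply: measurable_funB => //.
  exact: measurableT_comp.
have f0 (pu : measurableTypeR R * T) :
    (0 <= (`|a w pu.2 - pu.1| `^ alpha)%:E)%E.
  by rewrite lee_fin powR_ge0.
exact: (measurable_fun_fubini_tonelli_F (m2 := nu) _ mf f0).
Qed.

(** By the triangle inequality one of the two distances from [x] is at least
    half of [`|p - q|]. *)
Lemma powR_dist_pair (R : realType) (alpha p q x : R) : 0 < alpha ->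
  (`|p - q| / 2) `^ alpha <= `|x - p| `^ alpha + `|x - q| `^ alpha.
Proof.
move=> a0; have h : `|p - q| <= `|x - p| + `|x - q|.
  have -> : p - q = (x - q) - (x - p) by ring.
  by rewrite [leRHS]addrC ler_normB.
have [h1|h1] := leP (`|p - q| / 2) `|x - p|.
  apply: (@le_trans _ _ (`|x - p| `^ alpha)); last by rewrite lerDl powR_ge0.
  by rewrite ge0_ler_powR ?nnegrE ?divr_ge0// ltW.
apply: (@le_trans _ _ (`|x - q| `^ alpha)); last by rewrite lerDr powR_ge0.
by rewrite ge0_ler_powR ?nnegrE ?divr_ge0//; [rewrite ltW|lra].
Qed.

(** Le Cam's two-point argument: each word contributes to the two risks at least
    the smaller of its two probabilities times a loss that cannot be small for
    both parameters. *)
Lemma risk_pair_ge d (T : measurableType d) (R : realType)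
    (nu : probability T R) (alpha p q : R) n (a : n.-tuple bool -> T -> R) :
  0 < alpha -> (forall w, measurable_fun setT (a w)) ->
  1 / 4 <= p <= 3 / 4 -> 1 / 4 <= q <= 3 / 4 ->
  n%:R * (p - q) ^+ 2 <= 3 / 32 ->
  ((1 / 2 * (`|p - q| / 2) `^ alpha)%:E <=
   risk nu alpha a p + risk nu alpha a q)%E.
Proof.
move=> a0 ma hp hq hn.
set k := _ `^ _; have k0 : 0 <= k by rewrite powR_ge0.
pose I r w := (\int[nu]_u (`|a w u - r| `^ alpha)%:E)%E.
have mI r w : measurable_fun setT (fun u => (`|a w u - r| `^ alpha)%:E).
  by apply/measurable_EFinP; apply: measurable_abs_powR; exact: measurable_funB.
have I0 r w : (0 <= I r w)%E.
  by apply: integral_ge0 => u _; rewrite lee_fin powR_ge0.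
have Ipq w : (k%:E <= I p w + I q w)%E.
  have F0 r u : setT u -> (0 <= (`|a w u - r| `^ alpha)%:E)%E.
    by rewrite lee_fin powR_ge0.
  rewrite /I -(ge0_integralD nu measurableT (F0 p) (mI p w) (F0 q) (mI q w)).
  have -> : k%:E = (\int[nu]_u (cst k%:E u))%E.
    rewrite integral_cst// -[LHS]mule1; congr (_ * _)%E.
    exact/esym/probability_setT.
  apply: ge0_le_integral => //=.
  - by apply: emeasurable_funD; exact: mI.
  - by move=> u _; rewrite -EFinD lee_fin; exact: powR_dist_pair.
pose m (w : n.-tuple bool) := Num.min (word_prob p w) (word_prob q w).
have m0 w : 0 <= m w by rewrite /m le_min !word_prob_ge0//; lra.
have : ((\sum_w m w * k)%:E <= risk nu alpha a p + risk nu alpha a q)%E.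
  rewrite /risk -big_split/= -sumEFin; apply: lee_sum => w _.
  rewrite -/(I p w) -/(I q w).
  apply: (@le_trans _ _ ((m w)%:E * (I p w + I q w)))%E.
    by rewrite EFinM lee_wpmul2l// lee_fin.
  rewrite ge0_muleDr//; apply: leeD; apply: lee_wpmul2r => //;
    by rewrite lee_fin /m ge_min lexx ?orbT.
apply: le_trans; rewrite lee_fin -mulr_suml ler_wpM2r//.
exact: sum_min_word_prob.
Qed.

(** * The error of an estimate as a risk *)

(** Independence is a statement on the push-forward by [U] of [P] restricted to
    [E]: it is the law of [U] scaled by [P E]. *)
Lemma integral_indep_event d d' (T : measurableType d) (T' : measurableType d')
    (R : realType) (P : probability T R) (U : {RV P >-> T'}) (E : set T)
    (f : T' -> \bar R) :
  measurable E ->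
  (forall B, measurable B -> P ((U @^-1` B) `&` E) = P (U @^-1` B) * P E)%E ->
  measurable_fun setT f -> (forall y, 0 <= f y)%E ->
  (\int[P]_(x in E) f (U x) = P E * \int[distribution P U]_y f y)%E.
Proof.
move=> mE indep mf f0.
have mU : measurable_fun setT U by [].
have mfU : measurable_fun setT (f \o U) by exact: measurableT_comp.
have PEfin : P E \is a fin_num by exact: fin_num_measure.
have k0 : 0 <= fine (P E) by rewrite fine_ge0.
transitivity (\int[mrestr P mE]_(x in E) (f \o U) x)%E.
  by apply: eq_measure_integral => A mA AE; rewrite /= /mrestr setIidl.
transitivity (\int[mrestr P mE]_x (f \o U) x)%E.
  (* the complement of [E] is null for the restricted measure *)
  rewrite -[in RHS](setUv E) ge0_integral_setU//=; last 3 first.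
  - exact: measurableC.
  - by rewrite setUv.
  - exact/disj_setPCl.
  rewrite [X in (_ + X)%E](eq_measure_integral mzero).
    by rewrite integral_measure_zero adde0.
  by move=> A mA AE; rewrite /= /mrestr /mzero -(measure0 P); congr (P _);
    apply/disjoints_subset.
rewrite -[LHS](ge0_integral_pushforward mU _ measurableT mf)//.
rewrite (eq_measure_integral (mscale (NngNum k0) (distribution P U))).
  by rewrite ge0_integral_mscale//= fineK.
move=> A mA _; rewrite /= /mscale/= /pushforward /mrestr indep//.
by rewrite fineK// muleC.
Qed.

Definition word_event (T : Type) (W : nat -> T -> bool) n
    (w : n.-tuple bool) : set T :=
  [set x | [tuple W i x | i < n] = w].

Lemma word_event_bigcap (T : Type) (W : nat -> T -> bool) n
    (w : n.-tuple bool) :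
  word_event W w = \bigcap_(i in `I_n) (W i @^-1` [set nth false w i]).
Proof.
apply/seteqP; split => x /=.
  by move=> <- i /= ni; rewrite (nth_mktuple _ _ (Ordinal ni)).
move=> h; apply: eq_from_tnth => i; rewrite tnth_mktuple (tnth_nth false).
exact: (h i (ltn_ord i)).
Qed.

Lemma measurable_word_event d (T : measurableType d) (W : nat -> T -> bool) n
    (w : n.-tuple bool) : (forall i, measurable_fun setT (W i)) ->
  measurable (word_event W w).
Proof.
move=> mW; rewrite word_event_bigcap; apply: bigcap_measurableType => i _.
by rewrite -[_ @^-1` _]setTI; apply: mW.
Qed.

Lemma sigma_seq_word_event d (T : measurableType d) (W : nat -> T -> bool) n
    (w : n.-tuple bool) : sigma_seq W (word_event W w).
Proof.
rewrite word_event_bigcap /sigma_seq.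
set G := \bigcup_i _.
suff : @measurable _ (g_sigma_algebraType G)
  (\bigcap_(i in `I_n) (W i @^-1` [set nth false w i])) by [].
apply: bigcap_measurableType => i _.
apply: sub_sigma_algebra; exists i => //.
by exists [set nth false w i] => //; rewrite setTI.
Qed.

Lemma word_event_prob d (T : measurableType d) (R : realType)
    (P : probability T R) (W : nat -> {RV P >-> bool}) (p : R) n
    (w : n.-tuple bool) : iid_bernoulli p W ->
  P (word_event (fun i => W i : T -> bool) w) = (word_prob p w)%:E.
Proof.
move=> [indep law].
pose J : {fset nat} := [fset i | i in iota 0 n]%fset.
have JE : [set` J] = `I_n.
  by apply/seteqP; split => i /=; rewrite !inE/= mem_iota add0n.
rewrite word_event_bigcap -JE.
have -> := indep J (fun i => [set nth false w i]) (fun _ => I).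
have -> : (\prod_(i <- J) P (W i @^-1` [set nth false w i]) =
    \prod_(i <- iota 0 n) P (W i @^-1` [set nth false w i]))%E.
  apply: perm_big; apply: uniq_perm => //; first exact: iota_uniq.
  by move=> i; rewrite !inE.
rewrite -[in iota 0 n](subn0 n) -/(index_iota 0 n) big_mkord.
rewrite /word_prob -prodEFin; apply: eq_bigr => i _.
rewrite (tnth_nth false); have [pt pf] := law i.
by case: (nth false w i).
Qed.

(** An estimation function is only controlled for seeds in [0, 1); extending it
    by [0] makes it measurable on the whole line. *)
Definition seeded (R : realType) n (A : R * n.-tuple bool -> R)
    (w : n.-tuple bool) (u : R) : R :=
  if 0 <= u < 1 then A (u, w) else 0.

Lemma measurable_seeded (R : realType) n (A : R * n.-tuple bool -> R) w :
  estimation_function A -> measurable_fun [set: R] (seeded A w).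
Proof.
move=> [mA _].
have mD : measurable [set u : R | 0 <= u < 1].
  rewrite (_ : [set u | _] = `[0, 1[%classic); first exact: measurable_itv.
  by apply/seteqP; split => u /=; rewrite in_itv.
rewrite (_ : seeded A w = (fun u => A (u, w)) \_ [set u | 0 <= u < 1]).
  apply/(measurable_restrictT _ mD).
  apply: (@measurable_comp _ _ _ _ _ _
    ([set u : R | 0 <= u < 1] `*` [set: n.-tuple bool]) A) => //.
  - by apply: measurableX.
  - by move=> _ [u /= h <-].
  - exact: measurable_funTS.
apply/funext => u; rewrite /seeded patchE.
case: ifPn => h; first by rewrite mem_set.
by rewrite memNset//; exact/negP.
Qed.

Lemma estimate_risk d (Omega : measurableType d) (R : realType)
    (P : probability Omega R) (U : {RV P >-> R}) (W : nat -> {RV P >-> bool})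
    (A : forall n, R * n.-tuple bool -> R) (alpha p : R) n :
  (forall x, 0 <= U x < 1) -> independent_of_seq U W -> iid_bernoulli p W ->
  estimation_function (A n) ->
  ('E_P[fun x => (`|estimate A U (fun i => W i : Omega -> bool) n x - p|
                  `^ alpha)%R] =
   risk (distribution P U) alpha (seeded (A n)) p)%E.
Proof.
move=> U01 indep iid hA; rewrite unlock.
pose Ev := word_event (fun i => W i : Omega -> bool) (n := n).
have mEv w : measurable (Ev w) by apply: measurable_word_event => i.
pose h (w : n.-tuple bool) u : \bar R := (`|seeded (A n) w u - p| `^ alpha)%:E.
have mh w : measurable_fun setT (h w).
  apply/measurable_EFinP; apply: measurable_abs_powR.
  apply: measurable_funB => //.
  exact: measurable_seeded.
have h0 w u : (0 <= h w u)%E by rewrite lee_fin powR_ge0.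
have mhU w : measurable_fun setT (fun x => h w (U x)).
  by apply: measurableT_comp => //; exact: mh.
transitivity (\int[P]_x \sum_(w : n.-tuple bool)
    (((fun x => h w (U x)) \_ (Ev w)) x))%E.
  apply: eq_integral => x _.
  rewrite (bigD1 [tuple W i x | i < n])//= big1 => [|w wx].
    rewrite adde0 patchE mem_set//.
    by rewrite /h /seeded U01.
  by rewrite patchE memNset// => /= e; move: wx; rewrite -e eqxx.
rewrite ge0_integral_sum//=; last 2 first.
- move=> w; apply/(measurable_restrictT _ (mEv w)).
  by apply: measurable_funTS; exact: mhU.
- by move=> w x _; rewrite patchE; case: ifP.
apply: eq_bigr => w _; rewrite -integral_mkcond.
rewrite (integral_indep_event (mEv w) _ (mh w) (h0 w)); last first.
  by move=> B mB; apply: indep => //; exact: sigma_seq_word_event.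
by rewrite (word_event_prob _ iid).
Qed.

(** * Translation of the Lebesgue integral *)

Lemma shift_preimage_itv (R : realType) (t x y : R) b1 b2 :
  (fun r => r + t) @^-1` [set` Interval (BSide b1 x) (BSide b2 y)] =
  [set` Interval (BSide b1 (x - t)) (BSide b2 (y - t))].
Proof.
apply/seteqP; split => r /=; rewrite !in_itv/= => /andP[h1 h2]; apply/andP;
  split; move: h1 h2; case: b1; case: b2 => /=; lra.
Qed.

(** Both sides are measures that agree on the half-open intervals. *)
Lemma lebesgue_measure_shift (R : realType) (t : R) (A : set R) :
  measurable A ->
  pushforward mu ((fun r : R => r + t) : _ -> measurableTypeR R) A = mu A.
Proof.
have mt : measurable_fun [set: R] (fun r : R => r + t).
  by apply: measurable_funD.
move=> mA; apply/esym/lebesgue_measure_unique => //= _ [[a b]] _ <-.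
rewrite /pushforward shift_preimage_itv !lebesgue_measure_itv/=.
rewrite !lte_fin ltrD2r !EFinN; congr (if _ then _ else _).
by rewrite -!EFinB; congr (_%:E); lra.
Qed.

Lemma ge0_integral_shift (R : realType) (t x y : R) (f : R -> \bar R) :
  measurable_fun `[x, y]%classic f -> (forall r, x <= r <= y -> (0 <= f r)%E) ->
  (\int[mu]_(r in `[x, y]) f r =
   \int[mu]_(r in `[(x - t)%R, (y - t)%R]) f (r + t)%R)%E.
Proof.
have mt : measurable_fun [set: R] (fun r : R => r + t).
  by apply: measurable_funD.
move=> mf f0; rewrite -shift_preimage_itv.
rewrite -(@ge0_integral_pushforward _ _ (measurableTypeR R)
  (measurableTypeR R) R (fun r => r + t) mt mu)//=.
  apply: eq_measure_integral => //= A mA AS.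
  exact/esym/lebesgue_measure_shift.
by move=> r; rewrite inE/= in_itv/=; exact: f0.
Qed.

(** The interval shortened by [t] on the right and its translate by [t] both lie
    in [x, y]; the integral of [g] over each is at most the whole integral, and
    the sum of the two is the integral of the left-hand side of the pair bound. *)
Lemma integral_pair_bound (R : realType) (x y t c : R) (g : R -> R) :
  0 <= t -> 0 <= c ->
  measurable_fun `[x, y]%classic g -> (forall p, x <= p <= y -> 0 <= g p) ->
  (forall p, x <= p -> p + t <= y -> c <= g p + g (p + t)) ->
  ((c / 2 * (y - x - t))%:E <= \int[mu]_(p in `[x, y]) (g p)%:E)%E.
Proof.
move=> t0 c0 mg g0 gt.
have int0 : (0 <= \int[mu]_(p in `[x, y]) (g p)%:E)%E.
  by apply: integral_ge0 => p; rewrite /= in_itv/= lee_fin => /g0.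
have [yxt|xyt] := leP (y - t) x.
  apply: le_trans int0; rewrite lee_fin mulr_ge0_le0//; lra.
have D1 : `[x, y - t] `<=` `[x, y].
  by move=> p; rewrite /= !in_itv/= => /andP[-> h]; lra.
have D2 : `[x + t, y] `<=` `[x, y].
  by move=> p; rewrite /= !in_itv/= => /andP[h ->]; rewrite andbT; lra.
have mEg : measurable_fun `[x, y]%classic (EFin \o g) by exact/measurable_EFinP.
have le1 : (\int[mu]_(p in `[x, (y - t)%R]) (g p)%:E <=
    \int[mu]_(p in `[x, y]) (g p)%:E)%E.
  apply: ge0_subset_integral => //=.
have le2 : (\int[mu]_(p in `[x, (y - t)%R]) (g (p + t))%:E <=
    \int[mu]_(p in `[x, y]) (g p)%:E)%E.
  have <- : (\int[mu]_(p in `[(x + t)%R, y]) (g p)%:E =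
      \int[mu]_(p in `[x, (y - t)%R]) (g (p + t))%:E)%E.
    rewrite (@ge0_integral_shift _ t) ?addrK//.
      by apply: measurable_funS mEg.
    by move=> r hr; rewrite lee_fin g0//; lra.
  apply: ge0_subset_integral => //=.
have mshift : measurable_fun `[x, y - t]%classic (fun p => g (p + t)).
  apply: (@measurable_comp _ _ _ _ _ _ `[x, y]%classic g) => //.
    move=> _ [p /= + <-]; rewrite /= !in_itv/= => h; lra.
  exact: measurable_funD.
have /(le_trans _) : (\int[mu]_(p in `[x, (y - t)%R]) c%:E <=
    \int[mu]_(p in `[x, (y - t)%R]) ((g p)%:E + (g (p + t))%:E))%E.
  apply: ge0_le_integral => //=.
  - apply/measurable_EFinP; apply: measurable_funD => //.
    exact: measurable_funS mg.
  - by move=> p; rewrite /= in_itv/= => h; rewrite -EFinD lee_fin gt//; lra.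
rewrite ge0_integralD//=; last 4 first.
- by move=> p; rewrite /= in_itv/= => h; rewrite lee_fin g0//; lra.
- by apply/measurable_EFinP; apply: measurable_funS mg.
- by move=> p; rewrite /= in_itv/= => h; rewrite lee_fin g0//; lra.
- by apply/measurable_EFinP.
move=> /(_ _ (lexx _)).
rewrite integral_cst//= lebesgue_measure_itv/= lte_fin xyt -EFinD -EFinM.
set I := integral _ _ _ in int0 le1 le2 *.
move=> h; have {h le1 le2} := le_trans h (leeD le1 le2).
case: I int0 => [I| |]//= I0; last by move=> _; rewrite leey.
by rewrite -EFinD !lee_fin; lra.
Qed.

(** * Limits superior and weighted averages *)

(** Past some [N] the factors [delta n] are below [e / 2]; the first [N] terms
    contribute at most [N], which the diverging sum of weights absorbs. *)
Lemma weighted_average_cvg0 (R : realType) (v delta : nat -> R) :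
  (forall n, 0 <= v n <= 1) -> (forall n, 0 <= delta n <= 1) ->
  delta @ \oo --> (0 : R) ->
  (\sum_(1 <= n < m.+1) v n) @[m --> \oo] --> +oo ->
  forall e, 0 < e -> \forall m \near \oo,
    \sum_(1 <= n < m.+1) v n * delta n <= e * \sum_(1 <= n < m.+1) v n.
Proof.
move=> v01 d01 /cvgrPdist_le dcvg /cvgryPge vcvg e e0.
have e2 : 0 < e / 2 by rewrite divr_gt0.
have [N _ hN] := dcvg _ e2.
have [M _ hM] := vcvg (N%:R / (e / 2)).
exists M => // m /= /hM hm.
have vle : \sum_(1 <= n < m.+1) v n * delta n <=
    \sum_(1 <= n < m.+1) (e / 2 * v n + (n < N)%:R).
  apply: ler_sum => n _; have /andP[v0 v1] := v01 n; have /andP[d0 d1] := d01 n.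
  case: ltnP => [nN|Nn].
    apply: (@le_trans _ _ 1); first by rewrite mulr_ile1.
    by rewrite lerDr mulr_ge0// ltW.
  rewrite addr0 mulrC ler_wpM2r//; have := hN n Nn.
  by rewrite sub0r normrN ger0_norm.
apply: (le_trans vle); rewrite big_split/= -mulr_sumr.
have cnt : \sum_(1 <= n < m.+1) (n < N)%:R <= N%:R :> R.
  rewrite -natr_sum ler_nat.
  apply: (@leq_trans (\sum_(0 <= n < N + m.+1) (n < N))).
    rewrite [in leqRHS](@big_cat_nat _ _ _ 1)//= ?addn_gt0 ?orbT//.
    rewrite [in leqRHS](@big_cat_nat _ _ _ m.+1 1)//= ?leq_addl//.
    by rewrite addnCA leq_addr.
  rewrite (@big_cat_nat _ _ _ N)//= ?leq_addr//.
  have -> : (\sum_(N <= n < N + m.+1) (n < N) = 0)%N.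
    by rewrite big_nat big1// => i /andP[Ni _]; rewrite ltnNge Ni.
  rewrite addn0 big_nat (eq_bigr (fun=> 1%N)) => [|i /andP[_ ->]//].
  by rewrite -big_nat sum_nat_const_nat muln1 subn0.
rewrite ler_pdivrMr// in hm.
lra.
Qed.

Lemma le_limn_esup (R : realType) (u v : nat -> \bar R) :
  (forall n, (u n <= v n)%E) -> (limn_esup u <= limn_esup v)%E.
Proof.
move=> uv; rewrite !limn_esup_lim.
apply: lee_lim; [exact: is_cvg_esups|exact: is_cvg_esups|].
apply: nearW => n; apply: ge_ereal_sup => _ [m nm <-].
by apply: (le_trans (uv m)); apply: ereal_sup_ubound; exists m.
Qed.

Lemma limn_einf_le_near (R : realType) (u : nat -> \bar R) (l : \bar R) :
  (\forall n \near \oo, (u n <= l)%E) -> (limn_einf u <= l)%E.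
Proof.
move=> [N _ hN]; rewrite limn_einf_lim.
apply: lime_le; first exact: is_cvg_einfs.
apply: nearW => n; apply: (@le_trans _ _ (u (maxn n N))).
  by apply: ereal_inf_lbound; exists (maxn n N) => //=; rewrite leq_maxl.
by apply: hN => /=; rewrite leq_maxr.
Qed.

Lemma limn_esup_pZl (R : realType) (k : R) (u : nat -> \bar R) : 0 < k ->
  limn_esup (fun n => k%:E * u n)%E = (k%:E * limn_esup u)%E.
Proof.
move=> k0; rewrite !limn_esup_lim -limeMl//; last exact: is_cvg_esups.
congr (limn _); apply/funext => n; rewrite /esups/= -ereal_sup_pZl//.
congr (ereal_sup _); apply/seteqP; split => [_ [m nm <-]|_ [_ [m nm <-] <-]].
  by exists (u m) => //; exists m.
by exists m.
Qed.

Lemma le_limn_esup_scale (R : realType) (a c : nat -> R) (e : nat -> \bar R) :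
  (forall m, 0 <= e m)%E -> (forall m, a m <= c m) ->
  (limn_esup (fun m => (a m)%:E * e m) <=
   limn_esup (fun m => (c m)%:E * e m))%E.
Proof.
by move=> e0 ac; apply: le_limn_esup => m; rewrite lee_wpmul2r// lee_fin.
Qed.

(** * Limit superior of averages under a pair bound *)

(** Fatou's lemma is applied to the nonnegative functions [H m = b - G m], where
    [G m] is the weighted average. Their integrals over [x, y] have limit inferior
    at most [b / 2 * (y - x)] by the pair bound, while outside [Q] their limit
    inferior is at least [3 * b / 4]; hence the complement of [Q] has measure at
    most [2 / 3 * (y - x)]. *)
Lemma paired_limsup_bounded (R : realType) (x y b : R) (v delta : nat -> R)
    (g : nat -> R -> R) :
  let S m := \sum_(1 <= n < m.+1) v n in
  let Q := [set p | x <= p <= y /\ ((b / 4)%:E <=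
      limn_esup (fun m => (1 / S m * \sum_(1 <= n < m.+1) g n p)%:E))%E] in
  x < y -> 0 < b ->
  (forall n, 0 <= v n <= 1) -> (forall n, 0 <= delta n <= 1) ->
  delta @ \oo --> (0 : R) -> S m @[m --> \oo] --> +oo ->
  (forall n, measurable_fun `[x, y]%classic (g n)) ->
  (forall n p, x <= p <= y -> 0 <= g n p <= b * v n) ->
  (forall n p, (0 < n)%N -> x <= p -> p + delta n <= y ->
     b * v n <= g n p + g n (p + delta n)) ->
  measurable Q /\ (((y - x) / 3)%:E <= mu Q)%E.
Proof.
move=> S Q xy b0 v01 d01 dcvg Scvg mg g0 gd.
pose D := `[x, y]%classic : set R.
have mD : measurable D by exact: measurable_itv.
have DE p : D p = (x <= p <= y) :> Prop by rewrite /D/= in_itv.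
have muD : mu D = (y - x)%:E :> \bar R.
  by rewrite /D lebesgue_measure_itv/= lte_fin xy.
have S0 m : 0 <= S m by apply: sumr_ge0 => n _; case/andP: (v01 n).
pose G m p : R := 1 / S m * \sum_(1 <= n < m.+1) g n p.
have mG m : measurable_fun D (G m).
  by apply: measurable_funM => //; apply: measurable_sum.
have G0 m p : D p -> 0 <= G m p <= b.
  rewrite DE => hp; apply/andP; split.
    by rewrite mulr_ge0 ?divr_ge0// sumr_ge0// => n _; case/andP: (g0 n p hp).
  have le : \sum_(1 <= n < m.+1) g n p <= b * S m.
    by rewrite mulr_sumr ler_sum// => n _; case/andP: (g0 n p hp).
  have [Sm|Sm] := eqVneq (S m) 0; first by rewrite /G Sm invr0 mulr0 mul0r ltW.
  have Sm0 : 0 < S m by rewrite lt_neqAle eq_sym Sm S0.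
  by rewrite /G mulrAC ler_pdivrMr// mul1r.
pose H m p : \bar R := (b%:E + - (G m p)%:E)%E.
have mEG m : measurable_fun D (EFin \o G m) by exact/measurable_EFinP.
have mH m : measurable_fun D (H m).
  by apply: emeasurable_funB => //; exact: mEG.
have H0 m p : D p -> (0 <= H m p)%E.
  by move=> /(G0 m); rewrite /H -EFinB lee_fin; lra.
have EG0 m p : D p -> (0 <= (EFin \o G m) p)%E.
  by move=> /(G0 m)/andP[h _]; rewrite lee_fin.
have mesup : measurable_fun D (fun p => limn_esup (fun m => (G m p)%:E)).
  by apply: measurable_fun_limn_esup => //.
have QE : Q = D `&` (fun p => limn_esup (fun m => (G m p)%:E)) @^-1`
    [set z | ((b / 4)%:E <= z)%E].
  by apply/seteqP; split => p; rewrite /Q/= /D/= in_itv.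
have mQ : measurable Q.
  by rewrite QE; apply: emeasurable_fun_c_infty.
split => //.
have mDQ : measurable (D `\` Q) by apply: measurableD.
have intH m : (\int[mu]_(p in D) H m p + \int[mu]_(p in D) (G m p)%:E =
    (b * (y - x))%:E)%E.
  rewrite -(ge0_integralD mu mD (H0 m) (mH m) (EG0 m) (mEG m)).
  under eq_integral do rewrite /H -EFinB -EFinD subrK.
  by rewrite integral_cst//= muD -EFinM.
have intG m : ((1 / S m * (b / 2 * ((y - x) * S m -
    \sum_(1 <= n < m.+1) v n * delta n)))%:E <= \int[mu]_(p in D) (G m p)%:E)%E.
  under eq_integral do rewrite /G EFinM -sumEFin.
  rewrite ge0_integralZl//=; last 3 first.
  - by apply: emeasurable_sum => n; apply/measurable_EFinP; exact: mg.
  - move=> p; rewrite DE => hp; apply: sume_ge0 => n _.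
    by rewrite lee_fin; case/andP: (g0 n p hp).
  - by rewrite lee_fin divr_ge0.
  rewrite EFinM lee_wpmul2l ?lee_fin ?divr_ge0//.
  rewrite ge0_integral_sum//=; last 2 first.
  - by move=> n; apply/measurable_EFinP; exact: mg.
  - by move=> n p; rewrite DE => hp; rewrite lee_fin; case/andP: (g0 n p hp).
  have -> : b / 2 * ((y - x) * S m - \sum_(1 <= i < m.+1) v i * delta i) =
      \sum_(1 <= n < m.+1) (b * v n / 2 * (y - x - delta n)).
    rewrite /S mulr_sumr -sumrB mulr_sumr.
    by apply: eq_bigr => n _; ring.
  rewrite -sumEFin !big_nat; apply: lee_sum => n /andP[n0 _].
  apply: integral_pair_bound => //.
  - by case/andP: (d01 n).
  - by apply: mulr_ge0; [exact: ltW|case/andP: (v01 n)].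
  - by move=> p /(g0 n) /andP[].
  - by move=> p; exact: gd.
have lim e : 0 < e -> (limn_einf (fun m => \int[mu]_(p in D) H m p) <=
    (b / 2 * (y - x) + b / 2 * e)%:E)%E.
  move=> e0; apply: limn_einf_le_near.
  have h1 := weighted_average_cvg0 v01 d01 dcvg Scvg e0.
  have /cvgryPgt/(_ 0) h2 := Scvg.
  near=> m.
  have Sm : 0 < S m by near: m.
  have hm : \sum_(1 <= n < m.+1) v n * delta n <= e * S m by near: m.
  have := intG m.
  have := intH m.
  have IG0 : (0 <= \int[mu]_(p in D) (G m p)%:E)%E.
    by apply: integral_ge0 => p /(G0 m)/andP[h _]; rewrite lee_fin.
  have IH0 : (0 <= \int[mu]_(p in D) H m p)%E.
    by apply: integral_ge0 => p /H0.
  case: (\int[mu]_(p in D) H m p)%E IH0 => [r| |]//= _; last first.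
    by case: (\int[mu]_(p in D) (G m p)%:E)%E IG0.
  case: (\int[mu]_(p in D) (G m p)%:E)%E IG0 => [r'| |]//= _.
  rewrite -EFinD => -[] rr'; rewrite !lee_fin.
  set s := \sum_(_ <= _ < _) _ in hm *.
  have : 1 / S m * (b / 2 * ((y - x) * S m - s)) >= b / 2 * (y - x) - b / 2 * e.
    rewrite div1r [leRHS]mulrC ler_pdivlMr//.
    have : b / 2 * s <= b / 2 * (e * S m) by rewrite ler_wpM2l// divr_ge0// ltW.
    lra.
  lra.
have lim' : (limn_einf (fun m => \int[mu]_(p in D) H m p) <=
    (b / 2 * (y - x))%:E)%E.
  apply/lee_addgt0Pr => e e0.
  have e1 : 0 < e / (b / 2) by rewrite divr_gt0 ?divr_gt0.
  apply: (le_trans (lim _ e1)); rewrite -EFinD lee_fin.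
  by rewrite mulrCA divff ?mulr1// gt_eqF// divr_gt0.
have infH p : D p -> ~ Q p -> ((3 * b / 4)%:E <= limn_einf (H ^~ p))%E.
  move=> Dp nQ; rewrite limn_einf_shift//.
  have -> : limn_einf (fun m => - (G m p)%:E)%E =
      (- limn_esup (fun m => (G m p)%:E))%E.
    by rewrite -limn_einfN.
  have : (limn_esup (fun m => (G m p)%:E) < (b / 4)%:E)%E.
    rewrite ltNge; apply/negP => h; apply: nQ; by split.
  case: (limn_esup (fun m => (G m p)%:E)) => [r| |]//=; last by rewrite leey.
  by rewrite lte_fin -EFinB lee_fin; lra.
have minf : measurable_fun D (fun p => limn_einf (H ^~ p)).
  rewrite (_ : (fun p => _) = (fun p => - limn_esup (fun m => - H m p))%E)//.
  apply: measurableT_comp => //; apply: measurable_fun_limn_esup => // m.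
  exact: measurableT_comp.
have einf0 p : D p -> (0 <= limn_einf (H ^~ p))%E.
  move=> Dp; rewrite limn_einf_lim; apply: lime_ge; first exact: is_cvg_einfs.
  by apply: nearW => n; apply: le_ereal_inf_tmp => _ [m _ <-]; exact: H0.
have : ((3 * b / 4)%:E * mu (D `\` Q) <= (b / 2 * (y - x))%:E)%E.
  apply: le_trans lim'.
  apply: (le_trans _ (fatou mu _ mH H0)) => //.
  apply: (@le_trans _ _
      (\int[mu]_(p in D `\` Q) limn_einf (H ^~ p))%E); last first.
    by apply: ge0_subset_integral => //; exact: subDsetl.
  rewrite -integral_cst//; apply: ge0_le_integral => //=.
  - by move=> p _; rewrite lee_fin; lra.
  - by apply: measurable_funS minf => //; exact: subDsetl.
  - by move=> p []; exact: infH.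
have QD : Q `<=` D by rewrite QE; exact: subIsetl.
have : mu D = (mu (D `\` Q) + mu Q)%E.
  rewrite -[in LHS](setDUK QD) setUC measureU//.
  by rewrite setIC setICA setICr !setI0.
rewrite muD.
have := measure_ge0 mu (D `\` Q); have := measure_ge0 mu Q.
case: (mu (D `\` Q)) => [r| |]//=; case: (mu Q) => [r'| |]//=.
rewrite -EFinD !lee_fin => r'0 r0 [] rr'.
move=> h.
have : 3 * r <= 2 * (y - x) by rewrite -(ler_pM2l b0); lra.
lra.
Unshelve. all: by end_near.
Qed.

(** Without an upper bound, [f n] is replaced by its minimum with [b * v n]: the
    pair bound persists, and the averages only decrease. *)
Lemma paired_limsup (R : realType) (x y b : R) (v delta : nat -> R)
    (f : nat -> R -> \bar R) :
  let S m := \sum_(1 <= n < m.+1) v n in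
  let Q := [set p | x <= p <= y /\ ((b / 4)%:E <=
      limn_esup (fun m => (1 / S m)%:E * \sum_(1 <= n < m.+1) f n p))%E] in
  x < y -> 0 < b ->
  (forall n, 0 <= v n <= 1) -> (forall n, 0 <= delta n <= 1) ->
  delta @ \oo --> (0 : R) -> S m @[m --> \oo] --> +oo ->
  (forall n, measurable_fun `[x, y]%classic (f n)) ->
  (forall n p, x <= p <= y -> (0 <= f n p)%E) ->
  (forall n p, (0 < n)%N -> x <= p -> p + delta n <= y ->
     ((b * v n)%:E <= f n p + f n (p + delta n)%R)%E) ->
  measurable Q /\ (((y - x) / 3)%:E <= mu Q)%E.
Proof.
move=> S Q xy b0 v01 d01 dcvg Scvg mf f0 fd.
pose g n p : R := fine (mine (f n p) (b * v n)%:E).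
have bv0 n : 0 <= b * v n by apply: mulr_ge0; [exact: ltW|case/andP: (v01 n)].
have gE n p : x <= p <= y -> (g n p)%:E = mine (f n p) (b * v n)%:E.
  move=> hp; rewrite /g fineK// ge0_fin_numE; last first.
    by rewrite le_min f0//= lee_fin.
  by rewrite gt_min ltry orbT.
have mg n : measurable_fun `[x, y]%classic (g n).
  by apply: measurableT_comp => //; apply: measurable_mine.
have g0 n p : x <= p <= y -> 0 <= g n p <= b * v n.
  move=> hp; rewrite -!lee_fin gE// le_min f0//= lee_fin bv0/=.
  by rewrite ge_min lexx orbT.
have d0 n : 0 <= delta n by case/andP: (d01 n).
have gd n p : (0 < n)%N -> x <= p -> p + delta n <= y ->
    b * v n <= g n p + g n (p + delta n).
  move=> n0 xp py; have hd := d0 n.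
  have hp : x <= p <= y by lra.
  have hq : x <= p + delta n <= y by lra.
  rewrite -lee_fin EFinD !gE//.
  have f1 := f0 n _ hp; have f2 := f0 n _ hq.
  case: (leP (f n p) _) => h1; last by rewrite leeDl// le_min f2/= lee_fin.
  case: (leP (f n (p + delta n)) _) => h2; last by rewrite leeDr.
  exact: fd.
have [mQ' hQ'] := paired_limsup_bounded xy b0 v01 d01 dcvg Scvg mg g0 gd.
have mS : measurable_fun `[x, y]%classic (fun p =>
    limn_esup (fun m => (1 / S m)%:E * \sum_(1 <= n < m.+1) f n p))%E.
  apply: measurable_fun_limn_esup => m; apply: measurable_funeM.
  exact: emeasurable_sum.
have mQ : measurable Q.
  have -> : Q = `[x, y]%classic `&` [set p | (b / 4)%:E <=
      limn_esup (fun m => (1 / S m)%:E * \sum_(1 <= n < m.+1) f n p)]%E.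
    by apply/seteqP; split => p; rewrite /Q/= in_itv.
  exact: emeasurable_fun_c_infty.
split => //; apply: (le_trans hQ'); apply: le_measure; rewrite ?inE//.
move=> p [hp h]; split => //; apply: (le_trans h).
apply: le_limn_esup => m; rewrite EFinM lee_wpmul2l//.
  by rewrite lee_fin divr_ge0// sumr_ge0// => n _; case/andP: (v01 n).
by rewrite -sumEFin; apply: lee_sum => n _; rewrite gE// ge_min lexx.
Qed.

(** * The normalization [V] *)

(** By induction, from [ln (1 + 1 / m) <= 1 / m <= (1 / m) `^ (alpha / 2)]. *)
Lemma V_ge_ln (R : realType) (alpha : R) m :
  alpha <= 2 -> ln (m.+1%:R) <= V alpha m.
Proof.
move=> a2; rewrite /V; elim: m => [|m IH]; first by rewrite big_geq// ln1.
rewrite big_nat_recr//=.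
have m0 : 0 < m.+1%:R :> R by [].
have m2 : 0 < 1 / m.+1%:R :> R by rewrite divr_gt0.
have -> : m.+2%:R = m.+1%:R * (1 + 1 / m.+1%:R) :> R.
  by rewrite mulrDr mulr1 mulrCA divff// mulr1 -natr1.
rewrite lnM ?posrE// ?addr_gt0//.
apply: lerD => //; apply: (@le_trans _ _ (1 / m.+1%:R)).
  by rewrite le_ln1Dx// (lt_trans _ m2).
by rewrite ger1_powR// ?m2 ?div1r ?invf_le1 ?ler1n// ler_pdivrMr// mul1r.
Qed.

(** By induction: with [s = sqrt m] and [t = sqrt (m + 1)] one has
    [2 s (t - s) <= (t + s) (t - s) = 1]. *)
Lemma V1_ge_sqrt (R : realType) m :
  2 * (m.+1%:R `^ (1 / 2) - 1) <= V (1 : R) m.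
Proof.
rewrite /V; elim: m => [|m IH]; first by rewrite big_geq// powR1 subrr mulr0.
rewrite big_nat_recr//=; move: IH.
rewrite !div1r !powR12_sqrt ?invr_ge0// sqrtrV//.
set s := Num.sqrt m.+1%:R; set t := Num.sqrt m.+2%:R => IH.
have s0 : 0 < s by rewrite sqrtr_gt0.
have st : s < t by rewrite ltr_sqrt// ltr_nat.
have s2 : s ^+ 2 = m.+1%:R by rewrite sqr_sqrtr.
have t2 : t ^+ 2 = m.+2%:R by rewrite sqr_sqrtr.
suff : 2 * (t - s) <= s^-1 by lra.
have e : (t - s) * (t + s) = 1 by rewrite -subr_sqr t2 s2 -natrB ?subSnn.
have h : (t - s) * (2 * s) <= 1 by rewrite -[leRHS]e ler_wpM2l//; lra.
by rewrite -[leRHS]mul1r ler_pdivlMr//; lra.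
Qed.

Lemma cvgy_V (R : realType) (alpha : R) : alpha <= 2 ->
  V alpha m @[m --> \oo] --> +oo.
Proof.
move=> a2; apply/cvgryPge => M; near=> m.
apply: (le_trans _ (V_ge_ln m a2)).
rewrite -(expRK M) ler_ln ?posrE ?expR_gt0//.
near: m.
exists (Num.truncn (expR M)).+1 => // m /= hm.
apply: (le_trans (ltW (truncnS_gt _))).
by rewrite ler_nat (leq_trans hm).
Unshelve. all: by end_near. Qed.

(** * The gap between paired parameters *)

(** The distance for which [n * gap ^+ 2 = 3 / 32], the threshold of
    [sum_min_word_prob]; it is [0] for [n = 0]. *)
Definition gap (R : realType) (n : nat) : R :=
  Num.sqrt (1 / n%:R) / (2 * Num.sqrt (8 / 3)).

Lemma gap_sqr (R : realType) (n : nat) : n%:R * gap R n ^+ 2 <= 3 / 32.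
Proof.
rewrite /gap expr_div_n exprMn !sqr_sqrtr//.
case: n => [|n]; first by rewrite mul0r; lra.
have n0 : n.+1%:R != 0 :> R by [].
rewrite le_eqVlt; apply/orP; left; apply/eqP; field.
by rewrite addrC natr1.
Qed.

Lemma gap01 (R : realType) (n : nat) : 0 <= gap R n <= 1.
Proof.
have c1 : 1 <= Num.sqrt (8 / 3) :> R by rewrite -[leLHS]sqrtr1 ler_sqrt//; lra.
have s1 : Num.sqrt (1 / n%:R) <= 1 :> R.
  rewrite -[leRHS]sqrtr1 ler_sqrt// div1r.
  by case: n => [|n]; [rewrite invr0|rewrite invf_le1// ler1n].
have s0 : 0 <= Num.sqrt (1 / n%:R) :> R by rewrite sqrtr_ge0.
rewrite /gap divr_ge0//=.
by rewrite ler_pdivrMr; lra.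
Qed.

Lemma cvg_gap (R : realType) : gap R @ \oo --> (0 : R).
Proof.
apply/cvgrPdist_le => e e0.
exists (Num.truncn (e ^- 2)).+1 => // n /= hn.
have /andP[g0 _] := gap01 R n; rewrite sub0r normrN ger0_norm//.
have n0 : (0 < n)%N by apply: leq_trans hn.
have hn' : e ^- 2 <= n%:R.
  by apply: (le_trans (ltW (truncnS_gt _))); rewrite ler_nat.
have h1 : 1 <= n%:R * e ^+ 2.
  by rewrite -ler_pdivrMr ?exprn_gt0// div1r.
have h2 := gap_sqr R n.
have n1 : 0 < n%:R :> R by rewrite ltr0n.
rewrite -(@ler_pXn2r _ 2)// ?nnegrE// ?(ltW e0)//.
rewrite -(ler_pM2l n1); lra.
Qed.

(** The constant of the theorem is exactly a quarter of the two-point bound at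
    distance [gap R n], in units of [(1 / n) `^ (alpha / 2)]. *)
Lemma gap_powR (R : realType) (alpha : R) n :
  1 / 2 * (gap R n / 2) `^ alpha =
  4 * (1 / (Num.sqrt (8 / 3) `^ alpha * 2 `^ (3 + 2 * alpha))) *
  (1 / n%:R) `^ (alpha / 2).
Proof.
have c0 : 0 < Num.sqrt (8 / 3) :> R by rewrite sqrtr_gt0; lra.
have -> : (1 / n%:R) `^ (alpha / 2) = Num.sqrt (1 / n%:R) `^ alpha :> R.
  by rewrite -powR12_sqrt ?divr_ge0// -powRrM [2^-1 * _]mulrC.
have -> : gap R n / 2 = Num.sqrt (1 / n%:R) * (Num.sqrt (8 / 3) * 2 ^+ 2)^-1.
  rewrite /gap; field; exact: lt0r_neq0.
rewrite powRM ?sqrtr_ge0 ?invr_ge0 ?mulr_ge0// ?sqrtr_ge0//.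
set c := Num.sqrt (8 / 3) in c0 *; set r := Num.sqrt _.
have -> : (c * 2 ^+ 2)^-1 `^ alpha = (c `^ alpha * 2 `^ (2 * alpha))^-1 :> R.
  rewrite -[in LHS]powR_inv1 ?mulr_ge0 ?ltW// -powRrM mulN1r powRN.
  by rewrite powRrM powR_mulrn// powRM// ltW.
have h2 : 2 `^ (3 + 2 * alpha) = 2 ^+ 3 * 2 `^ (2 * alpha) :> R.
  rewrite powRD ?implybT//; last by apply/implyP.
  by rewrite powR_mulrn.
rewrite h2.
have x0 : c `^ alpha != 0 by rewrite gt_eqF// powR_gt0.
have y0 : 2 `^ (2 * alpha) != 0 :> R by rewrite gt_eqF// powR_gt0.
by field; apply/andP.
Qed.

(** * The set of parameters with a large error *)

Lemma borel_lebesgue_measurable (R : realType) (Q : set R) :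
  measurable Q -> lebesgue_measurable Q.
Proof. exact: sub_caratheodory. Qed.

Lemma uniform_probE (R : realType) (a b : R) (ab : a < b) (Q : set R) :
  measurable Q -> Q `<=` `[a, b] ->
  uniform_prob ab Q = ((b - a)^-1%:E * mu Q)%E.
Proof.
move=> mQ Qab; rewrite /uniform_prob -integral_cst//.
apply: eq_integral => x; rewrite inE => /Qab; rewrite /= in_itv/= => h.
by rewrite /uniform_pdf h.
Qed.

Theorem theorem2 (R : realType) (d : measure_display)
    (Omega : measurableType d) (P : probability Omega R)
    (U : {RV P >-> R}) (W : R -> nat -> {RV P >-> bool})
    (hU : uniform_seed U)
    (hW : forall p : R, 0 <= p <= 1 -> iid_bernoulli p (W p))
    (hUW : forall p : R, 0 <= p <= 1 -> independent_of_seq U (W p))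
    (alpha : R) (halpha : 0 < alpha <= 2)
    (A : forall n : nat, R * n.-tuple bool -> R)
    (hA : forall n : nat, (0 < n)%N -> estimation_function (A n)) :
  let X : R -> nat -> Omega -> R :=
    fun p => estimate A U (fun i => W p i : Omega -> bool) in
  let Q : set R :=
    [set p | 1 / 4 <= p <= 3 / 4 /\ error_bound P alpha p (X p)] in
  [/\ lebesgue_measurable Q,
      ((1 / 6)%:E <= completed_lebesgue_measure Q)%E,
      ((1 / 3)%:E <= uniform_prob (quarters_lt R) Q)%E &
      forall p : R, 0 <= p <= 1 -> error_bound P alpha p (X p) ->
        (alpha = 2 ->
          ((3 / 2 ^+ 10)%:E <=
           limn_esup (fun m : nat =>
             (1 / ln (m.+1%:R))%:E *
             \sum_(1 <= n < m.+1)
                'E_P[fun omega => (`|X p n omega - p| ^+ 2)%R]))%E) /\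
        (alpha = 1 ->
          ((1 / (2 ^+ 4 * Num.sqrt (8 / 3)))%:E <=
           limn_esup (fun m : nat =>
             (1 / (m.+1%:R `^ (1 / 2) - 1))%:E *
             \sum_(1 <= n < m.+1)
                'E_P[fun omega => `|X p n omega - p|%R]))%E)].
Proof.
move=> X Q; move: halpha => /andP[a0 a2].
pose theta : R := 1 / (Num.sqrt (8 / 3) `^ alpha * 2 `^ (3 + 2 * alpha)).
have c0 : 0 < Num.sqrt (8 / 3) :> R by rewrite sqrtr_gt0; lra.
have theta0 : 0 < theta by rewrite divr_gt0 ?mulr_gt0 ?powR_gt0.
(* [A 0] is unconstrained, so [f 0] is set to a measurable constant; the sums
   start at [n = 1]. *)
pose f n (p : R) : \bar R := if n is 0%N then 0%E else
  risk (distribution P U) alpha (seeded (A n)) p.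
have XE p n : 0 <= p <= 1 -> (0 < n)%N ->
    ('E_P[fun omega => (`|X p n omega - p| `^ alpha)%R] = f n p)%E.
  move=> p01 n0; rewrite /X estimate_risk//.
  - by case: n n0.
  - by case: hU.
  - exact: hUW.
  - exact: hW.
  - exact: hA.
have sumXE p m : 0 <= p <= 1 -> (\sum_(1 <= n < m.+1)
    'E_P[fun omega => (`|X p n omega - p| `^ alpha)%R] =
    \sum_(1 <= n < m.+1) f n p)%E.
  by move=> p01; apply: eq_big_nat => n /andP[n0 _]; exact: XE.
pose v n : R := (1 / n%:R) `^ (alpha / 2).
have v01 n : 0 <= v n <= 1.
  have <- : 1 `^ (alpha / 2) = 1 :> R by rewrite powR1.
  rewrite powR_ge0/= ge0_ler_powR ?nnegrE//.
    by rewrite divr_ge0 ?ltW.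
  by rewrite div1r; case: n => [|n]; [rewrite invr0|rewrite invf_le1// ler1n].
have QE : Q = [set p | 1 / 4 <= p <= 3 / 4 /\ ((4 * theta / 4)%:E <=
    limn_esup (fun m => (1 / (\sum_(1 <= n < m.+1) v n))%:E *
      \sum_(1 <= n < m.+1) f n p))%E].
  have e : 4 * theta / 4 = theta by rewrite mulrAC divff ?mul1r.
  rewrite e.
  have eE p m : 1 / 4 <= p <= 3 / 4 -> ((1 / V alpha m)%:E *
      \sum_(1 <= n < m.+1) 'E_P[fun omega => (`|X p n omega - p| `^ alpha)%R] =
      (1 / (\sum_(1 <= n < m.+1) v n))%:E * \sum_(1 <= n < m.+1) f n p)%E.
    by move=> hp; rewrite sumXE//; lra.
  by apply/seteqP; split => p [hp h]; split => //; move: h;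
    rewrite /error_bound (funext (fun m => eE p m hp)).
have [mQ hQ] : measurable Q /\ (((3 / 4 - 1 / 4) / 3)%:E <= mu Q)%E.
  rewrite QE; apply: (@paired_limsup R _ _ _ v (gap R) f) => //.
  - exact: quarters_lt.
  - by rewrite mulr_gt0.
  - exact: gap01.
  - exact: cvg_gap.
  - exact: cvgy_V.
  - case=> [|n]; first exact: measurable_cst.
    apply: measurable_funTS; apply: measurable_risk => w.
    by apply: measurable_seeded; exact: hA.
  - by case=> [|n] p hp//; apply: risk_ge0; lra.
  - case=> [//|n] p _ hp hq; have /andP[g0 _] := gap01 R n.+1.
    have gE : gap R n.+1 = `|p - (p + gap R n.+1)|.
      by rewrite opprD addrA subrr sub0r normrN ger0_norm.
    rewrite -gap_powR [X in (X / 2) `^ _]gE.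
    apply: risk_pair_ge => //.
    + by move=> w; apply: measurable_seeded; exact: hA.
    + lra.
    + lra.
    + by rewrite opprD addrA subrr sub0r sqrrN gap_sqr.
have h6 : (3 / 4 - 1 / 4) / 3 = 1 / 6 :> R by lra.
rewrite h6 in hQ.
split.
- exact: borel_lebesgue_measurable.
- exact: hQ.
- rewrite uniform_probE//; last by move=> p []; rewrite /= in_itv.
  have -> : (3 / 4 - 1 / 4 : R)^-1 = 2.
    by rewrite (_ : _ - _ = 2^-1) ?invrK//; lra.
  apply: (@le_trans _ _ (2%:E * (1 / 6)%:E)%E); last first.
    by rewrite lee_wpmul2l// lee_fin.
  by rewrite -EFinM lee_fin; lra.
move=> p p01; rewrite /error_bound -/theta => hp.
have sum0 m : (0 <= \sum_(1 <= n < m.+1)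
    'E_P[fun omega => (`|X p n omega - p| `^ alpha)%R])%E.
  by apply: sume_ge0 => n _; rewrite unlock; apply: integral_ge0 => x _;
    rewrite lee_fin powR_ge0.
have V0 m : (0 < m)%N -> 0 < V alpha m.
  by move=> m0; apply: lt_le_trans (V_ge_ln m a2); rewrite ln_gt0// ltr1n ltnS.
split => ea.
- have eX n : ('E_P[fun omega => (`|X p n omega - p| ^+ 2)%R] =
     'E_P[fun omega => (`|X p n omega - p| `^ alpha)%R])%E.
    by congr ('E_P[_]%E); apply/funext => omega; rewrite ea powR_mulrn.
  have <- : theta = 3 / 2 ^+ 10.
    rewrite /theta ea (_ : 3 + 2 * 2 = 7%:R); last by ring.
    rewrite !powR_mulrn ?ltW// sqr_sqrtr; last lra.
    by field.
  under eq_fun do under eq_bigr do rewrite eX.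
  apply: (le_trans hp); apply: le_limn_esup_scale => // -[|m].
    by rewrite /V big_geq// ln1.
  rewrite !div1r lef_pV2 ?posrE ?V0//; first exact: V_ge_ln.
  by rewrite ln_gt0// ltr1n.
- have eX n : ('E_P[fun omega => `|X p n omega - p|%R] =
     'E_P[fun omega => (`|X p n omega - p| `^ alpha)%R])%E.
    by congr ('E_P[_]%E); apply/funext => omega; rewrite ea powRr1.
  have -> : 1 / (2 ^+ 4 * Num.sqrt (8 / 3)) = 2 * theta.
    rewrite /theta ea (_ : 3 + 2 * 1 = 5%:R); last by ring.
    rewrite powR_mulrn// powRr1 ?ltW//.
    by field; exact: lt0r_neq0.
  under eq_fun do under eq_bigr do rewrite eX.
  apply: (@le_trans _ _ (limn_esup (fun m => (2 / V alpha m)%:E *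
      \sum_(1 <= n < m.+1)
        'E_P[fun omega => (`|X p n omega - p| `^ alpha)%R]))%E).
    have e2 m : 2 / V alpha m = 2 * (1 / V alpha m) by rewrite div1r.
    under eq_fun do rewrite e2 EFinM -muleA.
    by rewrite limn_esup_pZl// EFinM lee_wpmul2l// lee_fin.
  apply: le_limn_esup_scale => // -[|m].
    by rewrite /V big_geq// powR1 subrr !invr0 !mulr0.
  have s1 : 1 < m.+2%:R `^ (1 / 2) :> R.
    by rewrite div1r powR12_sqrt// -[ltLHS]sqrtr1 ltr_sqrt// ltr1n.
  have := V1_ge_sqrt R m.+1; have := V0 m.+1 isT; rewrite ea => v0 hv.
  rewrite ler_pdivrMr// mulrAC ler_pdivlMr; lra.
Qed.
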